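(* Let $\mathcal{T}_1$ be an $\mathcal{ALC}$ TBox, $\mathcal{T}_2$ a Horn-$\mathcal{ALC}$ TBox, and $\Theta=(\Sigma_1,\Sigma_2)$ a pair of signatures. Then $\mathcal{T}_1$ $\Theta$-rCQ entails $\mathcal{T}_2$ if and only if for every tree-shaped $\Sigma_1$-ABox $\mathcal{A}$ of outdegree at most $|\mathcal{T}_2|$ that is consistent with both $\mathcal{T}_1$ and $\mathcal{T}_2$, the canonical model $\mathcal{I}_{\mathcal{T}_2,\mathcal{A}}$ is con-$\Sigma_2$-homomorphically embeddable into every model $\mathcal{I}_1$ of $(\mathcal{T}_1,\mathcal{A})$.
   Context: $\mathcal{ALC}$ concepts are built from concept names and $\top$ using $\neg,\sqcap,\exists R.C$; a TBox is a finite set of inclusions $C\sqsubseteq D$, $|\mathcal{T}|$ denotes its size; it is Horn-$\mathcal{ALC}$ if no $\neg C$ occurs negatively and no $\exists R.\neg C$ occurs positively. An ABox is a finite set of assertions $A(a)$, $R(a,b)$; a $\Sigma_1$-ABox uses only names from $\Sigma_1$. An ABox $\mathcal{A}$ is tree-shaped if the undirected graph with nodes $\mathsf{ind}(\mathcal{A})$ and edges $\{a,b\}$ for $R(a,b)\in\mathcal{A}$ is a tree, and $R(a,b)\in\mathcal{A}$ implies $S(a,b)\notin\mathcal{A}$ for $S\ne R$ and $S(b,a)\notin\mathcal{A}$ for all $S$; its outdegree is the maximal number of children of a node in this tree. Interpretations satisfy $a^{\mathcal{I}}=a$. For a consistent Horn-$\mathcal{ALC}$ KB $(\mathcal{T},\mathcal{A})$,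 the canonical model $\mathcal{I}_{\mathcal{T},\mathcal{A}}$ is the model obtained by the standard chase: (with $\mathcal{T}$ in normal form, consisting of inclusions $A\sqsubseteq B$, $A_1\sqcap A_2\sqsubseteq B$, $\exists R.A\sqsubseteq B$, $A\sqsubseteq\bot$, $\top\sqsubseteq B$, $A\sqsubseteq\exists R.B$, $A\sqsubseteq\forall R.B$ over concept names) exhaustively add to $\mathcal{A}$ the assertions forced by the inclusions, introducing for $A(a)$ and $A\sqsubseteq\exists R.B$ a fresh $R$-successor in $B$ when none exists, and take the resulting possibly infinite ABox as an interpretation; it is a forest-shaped model that on its own is complete for the KB for UCQ answering. CQs are conjunctions of atoms $A(z)$, $R(z,z')$ with answer variables; a CQ is rooted (rCQ) if every quantified variable is connected (ignoring edge direction) to an answer variable. $\mathcal{K}\models q(\vec a)$ means all models satisfy $q(\vec a)$. $\mathcal{T}_1$ $\Theta$-rCQ entails $\mathcal{T}_2$ if for every $\Sigma_1$-ABox $\mathcal{A}$ consistent with both TBoxes and every rCQ $q(\vec x)$ over names in $\Sigma_2$ and tuple $\vec a$ from $\mathsf{ind}(\mathcal{A})$, $(\mathcal{T}_2,\mathcal{A})\models q(\vec a)$ implies $(\mathcal{T}_1,\mathcal{A})\models q(\vec a)$. A $\Sigma_2$-homomorphism from $\mathcal{I}$ to $\mathcal{J}$ preserves membership in $\Sigma_2$-concept names and $\Sigma_2$-role names and fixes every individual of $\mathcal{A}$ in its domain. The maximal $\Sigma_2$-connected subinterpretation of $\mathcal{I}$ is its restriction to $\mathsf{ind}(\mathcal{A})$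 plus all elements reachable from an individual by a path of $\Sigma_2$-role edges; $\mathcal{I}$ is con-$\Sigma_2$-homomorphically embeddable into $\mathcal{J}$ if there is a $\Sigma_2$-homomorphism from its maximal $\Sigma_2$-connected subinterpretation into $\mathcal{J}$. *)

(* Defs.v *)
From HB Require Import structures.
From mathcomp Require Import all_boot.

Set Implicit Arguments.
Unset Strict Implicit.
Unset Printing Implicit Defensive.

(* Names: three countably infinite sets. *)
Definition cname := nat.
Definition rname := nat.
Definition iname := nat.

Inductive concept :=
| Top
| Name of cname
| Neg of concept
| And of concept & concept
| Ex of rname & concept.

Definition concept_comparable : comparable concept.
Proof. by rewrite /comparable /decidable; do 2!decide equality. Defined.
HB.instance Definition _ := hasDecEq.Build concept (compareP concept_comparable).

Definition Bot : concept := Neg Top.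
Definition All (R : rname) (C : concept) : concept := Neg (Ex R (Neg C)).

(* An element (C, D) is the inclusion C [= D.  Lists stand for finite sets:
   only membership matters, and the size below ignores repetitions. *)
Definition tbox := seq (concept * concept).

Fixpoint concept_size (C : concept) : nat :=
  match C with
  | Top => 1
  | Name _ => 1
  | Neg D => (concept_size D).+1
  | And D E => (concept_size D + concept_size E).+1
  | Ex _ D => (concept_size D).+2
  end.

(* Number of occurrences of symbols. *)
Definition tbox_size (T : tbox) : nat :=
  \sum_(ci <- undup T) (concept_size ci.1 + concept_size ci.2).+1.

(* Occurrences of subconcepts with their polarity (true = positive).  As usual
   in the definition of Horn ontologies, the abbreviation All R D, that is,
   Neg (Ex R (Neg D)), counts as one constructor whose argument has the polarity
   of the whole; if its inner negation were counted as an occurrence, it would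
   be negative whenever All R D is positive, and the Horn normal form inclusions
   A [= All R B would not be Horn. *)
Fixpoint occurrences (p : bool) (C : concept) : seq (bool * concept) :=
  (p, C) ::
  match C with
  | Top | Name _ => [::]
  | Neg (Ex _ (Neg D)) => occurrences p D
  | Neg D => occurrences (~~ p) D
  | And D E => occurrences p D ++ occurrences p E
  | Ex _ D => occurrences p D
  end.

Definition occurs (p : bool) (C : concept) (T : tbox) : Prop :=
  exists2 ci, ci \in T &
    (p, C) \in occurrences false ci.1 ++ occurrences true ci.2.

Definition horn (T : tbox) : Prop :=
  (forall C, ~ occurs false (Neg C) T) /\
  (forall R C, ~ occurs true (Ex R (Neg C)) T).

Inductive assertion :=
| CAss of cname & iname
| RAss of rname & iname & iname.

Definition assertion_comparable : comparable assertion.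
Proof. by rewrite /comparable /decidable; do 2!decide equality. Defined.
HB.instance Definition _ :=
  hasDecEq.Build assertion (compareP assertion_comparable).

Definition abox := seq assertion.

Definition ind (A : abox) : seq iname :=
  flatten [seq match s with CAss _ a => [:: a] | RAss _ a b => [:: a; b] end
          | s <- A].

Record signature := Signature {
  sigC : cname -> Prop;
  sigR : rname -> Prop
}.

Definition sig_abox (S : signature) (A : abox) : Prop :=
  (forall B a, CAss B a \in A -> sigC S B) /\
  (forall R a b, RAss R a b \in A -> sigR S R).

Definition adj (A : abox) : rel iname := fun a b =>
  has (fun s => match s with
                | CAss _ _ => false
                | RAss _ c d => ((c == a) && (d == b)) || ((c == b) && (d == a))
                end) A.

Definition is_tree (V : seq iname) (e : rel iname) : Prop :=
  [/\ V != [::],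
      forall a b, a \in V -> b \in V ->
        exists2 p, path e a p & last a p = b
    & forall c, ucycle e c -> size c <= 2].

Definition tree_shaped (A : abox) : Prop :=
  [/\ is_tree (ind A) (adj A),
      forall R S a b, RAss R a b \in A -> S <> R -> RAss S a b \notin A
    & forall R S a b, RAss R a b \in A -> RAss S b a \notin A].

(* In the tree with root r, c is a child of its neighbour b iff b can be reached
   from r without visiting c. *)
Definition child (A : abox) (r b c : iname) : Prop :=
  adj A b c /\ exists p, [/\ path (adj A) r p, last r p = b & c \notin r :: p].

(* The root of the tree may be chosen. *)
Definition outdegree_le (k : nat) (A : abox) : Prop :=
  exists2 r, r \in ind A &
    forall b cs, b \in ind A -> uniq cs ->
      (forall c, c \in cs -> child A r b c) -> size cs <= k.

(* Standard names: the domain consists of the individual names, which denote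
   themselves, and of further anonymous elements. *)
Record interp := Interp {
  anon : Type;
  cint : cname -> iname + anon -> Prop;
  rint : rname -> iname + anon -> iname + anon -> Prop
}.

Definition dom (I : interp) : Type := (iname + anon I)%type.
Definition indiv (I : interp) (a : iname) : dom I := inl a.

Fixpoint cext (I : interp) (C : concept) (d : dom I) : Prop :=
  match C with
  | Top => True
  | Name A => cint A d
  | Neg D => ~ cext D d
  | And D E => cext D d /\ cext E d
  | Ex R D => exists2 e : dom I, rint R d e & cext D e
  end.

Definition sat_tbox (I : interp) (T : tbox) : Prop :=
  forall C D, (C, D) \in T -> forall d : dom I, cext C d -> cext D d.

Definition sat_abox (I : interp) (A : abox) : Prop :=
  (forall B a, CAss B a \in A -> cint B (indiv I a)) /\
  (forall R a b, RAss R a b \in A -> rint R (indiv I a) (indiv I b)).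

Definition model (T : tbox) (A : abox) (I : interp) : Prop :=
  sat_tbox I T /\ sat_abox I A.

Definition consistent (T : tbox) (A : abox) : Prop := exists I, model T A I.

Definition var := nat.

Inductive atom :=
| CAtom of cname & var
| RAtom of rname & var & var.

Definition atom_comparable : comparable atom.
Proof. by rewrite /comparable /decidable; do 2!decide equality. Defined.
HB.instance Definition _ := hasDecEq.Build atom (compareP atom_comparable).

(* All variables of the atoms that are not answer variables are existentially
   quantified. *)
Record cq := CQ { answer : seq var; atoms : seq atom }.

Definition atom_vars (t : atom) : seq var :=
  match t with CAtom _ x => [:: x] | RAtom _ x y => [:: x; y] end.

Definition quantified (q : cq) (x : var) : bool :=
  (x \in flatten (map atom_vars (atoms q))) && (x \notin answer q).

Inductive qconnected (q : cq) (x : var) : var -> Prop :=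
| qconn_refl : qconnected q x x
| qconn_fwd R y z :
    qconnected q x y -> RAtom R y z \in atoms q -> qconnected q x z
| qconn_bwd R y z :
    qconnected q x y -> RAtom R z y \in atoms q -> qconnected q x z.

Definition rooted (q : cq) : Prop :=
  forall y, quantified q y -> exists2 x, x \in answer q & qconnected q x y.

Definition sig_cq (S : signature) (q : cq) : Prop :=
  (forall B x, CAtom B x \in atoms q -> sigC S B) /\
  (forall R x y, RAtom R x y \in atoms q -> sigR S R).

Definition sat_cq (I : interp) (q : cq) (a : seq iname) : Prop :=
  exists2 v : var -> dom I,
    map v (answer q) = map (indiv I) a &
    (forall B x, CAtom B x \in atoms q -> cint B (v x)) /\
    (forall R x y, RAtom R x y \in atoms q -> rint R (v x) (v y)).

Definition entails_cq (T : tbox) (A : abox) (q : cq) (a : seq iname) : Prop :=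
  forall I, model T A I -> sat_cq I q a.

Definition rcq_entails (Theta : signature * signature) (T1 T2 : tbox) : Prop :=
  forall A, sig_abox Theta.1 A -> consistent T1 A -> consistent T2 A ->
  forall (q : cq) (a : seq iname),
    rooted q -> sig_cq Theta.2 q ->
    size a = size (answer q) -> {subset a <= ind A} ->
    entails_cq T2 A q a -> entails_cq T1 A q a.

(* Normal form inclusions.  The names occurring in them are indexed by concepts:
   the index Name A is the concept name A itself, and any other index C is the
   fresh name that the normalisation introduces for the subconcept C. *)
Inductive nci :=
| NSub of concept & concept               (* A [= B *)
| NAnd of concept & concept & concept     (* A1 |^| A2 [= B *)
| NExL of rname & concept & concept       (* Ex R A [= B *)
| NBot of concept                         (* A [= Bot *)
| NTop of concept                         (* Top [= B *)
| NExR of concept & rname & concept       (* A [= Ex R B *)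
| NAll of concept & rname & concept.      (* A [= All R B *)

Definition nci_comparable : comparable nci.
Proof.
move=> x y; rewrite /decidable.
by decide equality; (apply: concept_comparable || decide equality).
Defined.
HB.instance Definition _ := hasDecEq.Build nci (compareP nci_comparable).

(* Inclusions making (the name for) C subsume C. *)
Fixpoint norm_neg (C : concept) : seq nci :=
  match C with
  | Top => [:: NTop Top]
  | Name _ => [::]
  | And D E => NAnd D E C :: norm_neg D ++ norm_neg E
  | Ex R D => NExL R D C :: norm_neg D
  | Neg _ => [::]  (* does not occur negatively in a Horn TBox *)
  end.

(* Inclusions making (the name for) C subsumed by C. *)
Fixpoint norm_pos (C : concept) : seq nci :=
  match C with
  | Top | Name _ => [::]
  | And D E => [:: NSub C D, NSub C E & norm_pos D ++ norm_pos E]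
  | Ex R D => NExR C R D :: norm_pos D
  | Neg (Ex R (Neg D)) => NAll C R D :: norm_pos D
  | Neg D => [:: NAnd C D Bot, NBot Bot & norm_neg D]
  end.

Definition normal_form (T : tbox) : seq nci :=
  flatten [seq NSub ci.1 ci.2 :: norm_neg ci.1 ++ norm_pos ci.2 | ci <- T].

(* Elements of the chase: individuals, and Succ t R B, the fresh R-successor in B
   introduced for t. *)
Inductive elt :=
| Ind of iname
| Succ of elt & rname & concept.

Record cstate := CState {
  cdom : elt -> Prop;
  cfact : concept -> elt -> Prop;
  rfact : rname -> elt -> elt -> Prop
}.

(* All individual names belong to the domain of every interpretation; those
   outside ind A carry no assertion. *)
Definition chase_init (A : abox) : cstate := CState
  (fun t => exists a, t = Ind a)
  (fun C t => exists B a, [/\ C = Name B, t = Ind a & CAss B a \in A])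
  (fun R t u => exists a b, [/\ t = Ind a, u = Ind b & RAss R a b \in A]).

Section ChaseStep.
Variables (N : seq nci) (s : cstate).

Definition needs_succ (t : elt) (R : rname) (B : concept) : Prop :=
  (exists2 A, NExR A R B \in N & cfact s A t) /\
  ~ (exists2 u, rfact s R t u & cfact s B u).

Inductive step_dom : elt -> Prop :=
| sd_old t : cdom s t -> step_dom t
| sd_new t R B : needs_succ t R B -> step_dom (Succ t R B).

Inductive step_rfact : rname -> elt -> elt -> Prop :=
| sr_old R t u : rfact s R t u -> step_rfact R t u
| sr_new t R B : needs_succ t R B -> step_rfact R t (Succ t R B).

Inductive step_cfact : concept -> elt -> Prop :=
| sc_old B t : cfact s B t -> step_cfact B t
| sc_sub A B t : NSub A B \in N -> cfact s A t -> step_cfact B t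
| sc_and A1 A2 B t : NAnd A1 A2 B \in N ->
    cfact s A1 t -> cfact s A2 t -> step_cfact B t
| sc_exl R A B t u : NExL R A B \in N ->
    rfact s R t u -> cfact s A u -> step_cfact B t
| sc_top B t : NTop B \in N -> cdom s t -> step_cfact B t
| sc_all A R B t u : NAll A R B \in N ->
    cfact s A t -> rfact s R t u -> step_cfact B u
| sc_new t R B : needs_succ t R B -> step_cfact B (Succ t R B).

(* Every applicable rule is applied simultaneously, so that iterating the step is
   a fair exhaustive chase.  Inclusions A [= Bot never apply to a consistent
   knowledge base and add nothing. *)
Definition chase_step : cstate := CState step_dom step_cfact step_rfact.

End ChaseStep.

Definition chase (T : tbox) (A : abox) (n : nat) : cstate :=
  iter n (chase_step (normal_form T)) (chase_init A).

Definition is_succ (t : elt) : bool :=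
  if t is Succ _ _ _ then true else false.

Definition chase_null (T : tbox) (A : abox) : Type :=
  {t : elt | is_succ t /\ exists n, cdom (chase T A n) t}.

Definition chase_elt (T : tbox) (A : abox) (d : iname + chase_null T A) : elt :=
  match d with inl a => Ind a | inr t => proj1_sig t end.

Definition canonical_model (T : tbox) (A : abox) : interp := @Interp
  (chase_null T A)
  (fun B d => exists n, cfact (chase T A n) (Name B) (chase_elt d))
  (fun R d e => exists n, rfact (chase T A n) R (chase_elt d) (chase_elt e)).

(* Domain of the maximal S-connected subinterpretation. *)
Inductive con_dom (S : signature) (A : abox) (I : interp) : dom I -> Prop :=
| con_ind a : a \in ind A -> con_dom S A (indiv I a)
| con_step R d e : con_dom S A d -> sigR S R -> rint R d e -> con_dom S A e.

(* h is an S-homomorphism to J from the restriction of I to the subset P of its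
   domain; the values of h outside P are irrelevant. *)
Definition sig_hom (S : signature) (A : abox) (I J : interp)
    (P : dom I -> Prop) (h : dom I -> dom J) : Prop :=
  [/\ forall B d, sigC S B -> P d -> cint B d -> cint B (h d),
      forall R d e, sigR S R -> P d -> P e -> rint R d e -> rint R (h d) (h e)
    & forall a, a \in ind A -> P (indiv I a) -> h (indiv I a) = indiv J a].

Definition con_hom_embeddable (S : signature) (A : abox) (I J : interp) : Prop :=
  exists h : dom I -> dom J, sig_hom S A (@con_dom S A I) h.

(* Main.v *)
From Stdlib Require List.
Require Import Defs.
From mathcomp Require Import all_boot boolp.

(** From entailment to embeddings: keeping only ABox edges and one witness per
    existential subconcept of [T1] turns a model of [T1] and [A] into a finitely
    branching one.  Every finite connected part of the chase is a rooted query that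
    [T2] entails, so it maps into that model, and these partial maps range over
    finite balls around the individuals; a compactness argument glues them.

    From embeddings to entailment: a query that [T2] entails over an arbitrary ABox
    [A] is matched in the chase, which consists of [A] and of trees hanging off its
    individuals.  Up to any fixed round, the tree at [b] depends only on a finite
    tree-shaped unravelling of [A] at [b] that keeps, for each inclusion
    [Ex R D [= C] or [C [= All R D], one neighbour where the premise is derived
    earliest.  The hypothesis on that unravelling, applied to a model of [T1] and
    [A] with renamed individuals, maps the tree at [b] into the given model. *)

Set Implicit Arguments.
Unset Strict Implicit.
Unset Printing Implicit Defensive.

(** * Monotone families indexed by stages *)

Lemma common_stage (X : eqType) (P : nat -> X -> Prop) (s : seq X) :
  (forall m n x, m <= n -> P m x -> P n x) ->
  (forall x, x \in s -> exists n, P n x) ->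
  exists n, forall x, x \in s -> P n x.
Proof.
move=> Pmono; elim: s => [|y s IHs] Ps; first by exists 0.
have [n1 Pn1] := Ps y (mem_head y s).
have [n2 Pn2] : exists n, forall x, x \in s -> P n x.
  by apply: IHs => x xs; apply: Ps; rewrite inE xs orbT.
exists (maxn n1 n2) => x; rewrite inE => /orP[/eqP->|/Pn2].
  exact: Pmono (leq_maxl _ _) Pn1.
exact: Pmono (leq_maxr _ _).
Qed.

(** Choose the witness at the least stage that has one: every stage with a witness comes no earlier,
    and [Xmono] carries the chosen one there. *)
Lemma earliest_witness (S : iname -> Prop) (X : nat -> iname -> Prop) :
  (forall m n c, m <= n -> X m c -> X n c) ->
  (exists n c, S c /\ X n c) ->
  exists c, S c /\ forall n c', S c' -> X n c' -> X n c.
Proof.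
move=> Xmono exX; pose p n := `[< exists c, S c /\ X n c >].
have exp : exists n, p n by have [n [c ?]] := exX; exists n; apply/asboolP; exists c.
case: (ex_minnP exp) => n /asboolP[c [Sc Xc]] nmin; exists c; split=> // m c' Sc' Xc'.
by apply: Xmono Xc; apply: nmin; apply/asboolP; exists c'.
Qed.

(** * The chase *)

Fixpoint elt_root (t : elt) : iname :=
  match t with Ind a => a | Succ u _ _ => elt_root u end.

Lemma ind_concept (A : abox) B a : CAss B a \in A -> a \in ind A.
Proof.
by move=> Ba; apply/flatten_mapP; exists (CAss B a); rewrite ?mem_head.
Qed.

Lemma ind_role (A : abox) R a b : RAss R a b \in A -> a \in ind A /\ b \in ind A.
Proof.
move=> Rab; split; apply/flatten_mapP; exists (RAss R a b);
  by rewrite // !inE eqxx ?orbT.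
Qed.

Section Chase.
Variables (T : tbox) (A : abox).
Notation N := (normal_form T).

Lemma chase_mono m n : m <= n ->
  [/\ forall t, cdom (chase T A m) t -> cdom (chase T A n) t,
      forall C t, cfact (chase T A m) C t -> cfact (chase T A n) C t
    & forall R t u, rfact (chase T A m) R t u -> rfact (chase T A n) R t u].
Proof.
move/subnK <-; elim: (n - m) => [|k [IHd IHc IHr]]; first by split.
by split=> [t /IHd|C t /IHc|R t u /IHr] ?; rewrite addSn; constructor.
Qed.

Lemma cfact_mono m n C t : m <= n -> cfact (chase T A m) C t -> cfact (chase T A n) C t.
Proof. by case/chase_mono=> _ + _; apply. Qed.

Lemma rfact_mono m n R t u :
  m <= n -> rfact (chase T A m) R t u -> rfact (chase T A n) R t u.
Proof. by case/chase_mono=> _ _; apply. Qed.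

(** No chase rule links two existing elements: beyond the ABox, an edge appears only together with
    its target, so trees grow below the individuals. *)
Lemma rfact_inv n R t u : rfact (chase T A n) R t u ->
  (exists a b, [/\ t = Ind a, u = Ind b & RAss R a b \in A]) \/
  (exists B m, [/\ m < n, u = Succ t R B & needs_succ N (chase T A m) t R B]).
Proof.
elim: n R t u => [|n IHn] R t u /=; first by left.
case=> [R' t' u' /IHn[|[B [m [mn -> Hm]]]]|t' R' B Hn]; first by left.
- by right; exists B, m; split=> //; apply: ltnW.
- by right; exists B, n.
Qed.

Lemma rfact_ind n R t b : rfact (chase T A n) R t (Ind b) ->
  exists2 a, t = Ind a & RAss R a b \in A.
Proof.
case/rfact_inv=> [[a [c [-> [->] Rab]]]|[B [m []]]] //.
by exists a.
Qed.

Lemma rfact_succ n R t u R' B : rfact (chase T A n) R t (Succ u R' B) ->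
  [/\ u = t, R' = R & exists2 m, m < n & needs_succ N (chase T A m) t R B].
Proof.
by case/rfact_inv=> [[a [c []]]|[B' [m [mn [-> -> ->] nS]]]] //; split=> //; exists m.
Qed.

Lemma cdom_rfact n R t u : rfact (chase T A n) R t u -> exists k, cdom (chase T A k) u.
Proof.
case/rfact_inv=> [[a [c [_ -> _]]]|[B [m [_ -> nS]]]]; first by exists 0, c.
by exists m.+1; apply: sd_new.
Qed.

Lemma chase_elt_onto n R t u : rfact (chase T A n) R t u ->
  exists e : dom (canonical_model T A), chase_elt e = u.
Proof.
case: u => [b|u R' B] H; first by exists (inl b).
have ex : exists k, cdom (chase T A k) (Succ u R' B) by apply: cdom_rfact H.
by exists (inr (exist _ (Succ u R' B) (conj isT ex))).
Qed.

Lemma cdom_chase_elt (d : dom (canonical_model T A)) :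
  exists n, cdom (chase T A n) (chase_elt d).
Proof. by case: d => [a|[t [_ ?]]] //; exists 0, a. Qed.

End Chase.

(** * Semantics of the normal form *)

Definition nci_holds (J : interp) (x : nci) : Prop :=
  match x with
  | NSub B C => forall d : dom J, cext B d -> cext C d
  | NAnd B1 B2 C => forall d : dom J, cext B1 d -> cext B2 d -> cext C d
  | NExL R B C => forall d e : dom J, rint R d e -> cext B e -> cext C d
  | NBot B => forall d : dom J, ~ cext B d
  | NTop B => forall d : dom J, cext B d
  | NExR B R C => forall d : dom J, cext B d -> exists e, rint R d e /\ cext C e
  | NAll B R C => forall d e : dom J, cext B d -> rint R d e -> cext C e
  end.

(** Once each index is read as the concept itself, the inclusions of [norm_neg], like those of
    [norm_pos], are valid in every interpretation; only the [NSub] of a TBox inclusion depends on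
    [J]. *)
Lemma norm_neg_holds (J : interp) C x : x \in norm_neg C -> nci_holds J x.
Proof.
elim: C => [||D _|D IHD E IHE|R D IHD] //=.
- by rewrite inE => /eqP->.
- by rewrite inE mem_cat => /orP[/eqP->|/orP[/IHD|/IHE]].
- by rewrite inE => /orP[/eqP-> d e de De|/IHD //]; exists e.
Qed.

Lemma concept_size_ind (P : concept -> Prop) :
  (forall C, (forall D, concept_size D < concept_size C -> P D) -> P C) ->
  forall C, P C.
Proof.
move=> IH C; have [n] := ubnP (concept_size C); elim: n C => // n IHn C Cn.
by apply: IH => D DC; apply: IHn; apply: leq_trans DC _.
Qed.

(** Follows the case split of [norm_pos] and [occurrences] on the argument of [Neg], where [All R D]
    counts as one constructor. *)
Variant neg_shape : concept -> Prop :=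
| NegAll R D : neg_shape (Ex R (Neg D))
| NegOther D of norm_pos (Neg D) = [:: NAnd (Neg D) D Bot, NBot Bot & norm_neg D]
    & (forall p, occurrences p (Neg D) = (p, Neg D) :: occurrences (~~ p) D) :
    neg_shape D.

Lemma neg_shapeP D : neg_shape D.
Proof.
case: D => [|B|D|D E|R [|B|D|D E|S D]]; try exact: NegOther.
exact: NegAll.
Qed.

Lemma norm_pos_holds (J : interp) C x : x \in norm_pos C -> nci_holds J x.
Proof.
elim/concept_size_ind: C => -[//|//|D|D E|R D] IH.
- case: (neg_shapeP D) IH => [R E|E -> _] IH.
    rewrite inE => /orP[/eqP-> d e nex de|]; last by apply: IH; rewrite /= ltnS; do 3!apply: leqW.
    by apply: contrapT => nE; apply: nex; exists e.
  rewrite !inE => /or3P[/eqP-> d /= nE /nE //|/eqP-> d /=|/norm_neg_holds //].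
  by apply.
- rewrite /= !inE mem_cat => /or4P[/eqP-> d [] //|/eqP-> d [] //||];
    by apply: IH; rewrite /= ltnS ?leq_addr ?leq_addl.
- rewrite inE => /orP[/eqP-> d [e de De]|]; first by exists e.
  by apply: IH => /=.
Qed.

Lemma mem_normal_form (T : tbox) x : reflect
  (exists2 ci, ci \in T & x \in NSub ci.1 ci.2 :: norm_neg ci.1 ++ norm_pos ci.2)
  (x \in normal_form T).
Proof. exact: flatten_mapP. Qed.

Lemma normal_form_holds (J : interp) (T : tbox) x :
  sat_tbox J T -> x \in normal_form T -> nci_holds J x.
Proof.
move=> JT /mem_normal_form[[C D] CD].
rewrite inE mem_cat => /or3P[/eqP-> d|/norm_neg_holds //|/norm_pos_holds //].
exact: JT CD d.
Qed.

(** * Mapping chase trees into models *)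

Section TreeMap.
Variable J : interp.

(* Junk value d when d has no R-successor in B. *)
Definition succ_choice (d : dom J) (R : rname) (B : concept) : dom J :=
  if pselect (exists e, rint R d e /\ cext B e) is left p
  then projT1 (cid p) else d.

Lemma succ_choiceP d R B : (exists e, rint R d e /\ cext B e) ->
  rint R d (succ_choice d R B) /\ cext B (succ_choice d R B).
Proof. by rewrite /succ_choice => ex; case: pselect => // p; case: cid. Qed.

(** A chase element records how it was created and so spells a path of witnesses in [J]; [x] stands
    for its root, whichever individual that is. *)
Fixpoint tree_map (x : dom J) (t : elt) : dom J :=
  match t with Ind _ => x | Succ u R B => succ_choice (tree_map x u) R B end.

Variables (T : tbox) (A : abox) (P : nat -> iname -> dom J -> Prop).
Hypothesis JT : sat_tbox J T.
Hypothesis P_pred : forall n a x, P n.+1 a x -> P n a x.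
Hypothesis P_concept : forall n a x B, P n a x -> CAss B a \in A -> cint B x.
Hypothesis P_ex : forall n a x R D C c,
  P n.+1 a x -> NExL R D C \in normal_form T ->
  RAss R a c \in A -> cfact (chase T A n) D (Ind c) ->
  exists c' y, [/\ P n c' y, rint R x y & cfact (chase T A n) D (Ind c')].
Hypothesis P_all : forall n a x R D C c,
  P n.+1 a x -> NAll C R D \in normal_form T ->
  RAss R c a \in A -> cfact (chase T A n) C (Ind c) ->
  exists c' y, [/\ P n c' y, rint R y x & cfact (chase T A n) C (Ind c')].

(* P n a x says that x simulates the individual a for n rounds of the chase. *)
Lemma tree_map_sound n t x : P n (elt_root t) x ->
  (forall C, cfact (chase T A n) C t -> cext C (tree_map x t)) /\
  (forall R u, rfact (chase T A n) R u t -> is_succ t ->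
     rint R (tree_map x u) (tree_map x t)).
Proof.
elim: n t x => [|n IHn] t x Px.
  split=> [C [B [a [-> ta Ba]]]|R u [a [b [_ -> _]]]] //.
  by rewrite ta /= in Px *; apply: P_concept Px Ba.
have [IHc IHr] := IHn t x (P_pred Px).
have holds := normal_form_holds JT.
have new u R B : elt_root u = elt_root t -> needs_succ (normal_form T) (chase T A n) u R B ->
    rint R (tree_map x u) (tree_map x (Succ u R B)) /\ cext B (tree_map x (Succ u R B)).
  move=> ru [[C /holds CRB Cu] _]; apply: succ_choiceP; apply: CRB.
  by have [] := IHn u x _; [rewrite ru; apply: P_pred|move=> + _; apply].
split=> [C|R u] /=.
  move=> step; case: step Px IHc IHr new => {C t}.
  - by move=> C t Ct _ IHc _ _; apply: IHc.
  - by move=> B C t /holds BC Bt _ IHc _ _; apply: BC; apply: IHc.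
  - by move=> B1 B2 C t /holds BC B1t B2t _ IHc _ _; apply: BC; apply: IHc.
  (* An edge into an individual is an ABox edge; [P_ex] then offers a simulated neighbour with the
     same premise, possibly a copy of another individual than [c]. An edge into a successor joins it
     to its parent inside the tree. *)
  - move=> R B C t [c|u R' B'] BC tu Bu Px _ _ _.
      have [a ta Rac] := rfact_ind tu; rewrite {}ta /= in Px *.
      have [c' [y [Py xy By]]] := P_ex Px BC Rac Bu.
      by apply: (holds _ BC) xy _; have [+ _] := IHn (Ind c') y Py; apply.
    have [ut _ _] := rfact_succ tu; subst u.
    have [IHc IHr] := IHn (Succ t R' B') x (P_pred Px).
    exact: (holds _ BC) (IHr _ _ tu isT) (IHc _ Bu).
  - by move=> B t /holds Btop *; apply: Btop.
  - move=> B R C t [b|u R' B'] BC Bt tu Px _ _ _.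
      have [a ta Rab] := rfact_ind tu; rewrite {}ta /= in Bt Px *.
      have [c' [y [Py yx By]]] := P_all Px BC Rab Bt.
      by apply: (holds _ BC _ _ _ yx); have [+ _] := IHn (Ind c') y Py; apply.
    have [ut _ _] := rfact_succ tu; subst u.
    have [_ IHr] := IHn (Succ t R' B') x (P_pred Px).
    have [IHc _] := IHn t x (P_pred Px).
    exact: (holds _ BC) (IHc _ Bt) (IHr _ _ tu isT).
  - by move=> t R B nS _ _ _ /(_ t _ _ erefl nS)[].
move=> step; case: step Px IHc IHr new => {R t u} [R t u tu|t R B nS] _ _ IHr new us.
  exact: IHr.
by have [] := new t _ _ erefl nS.
Qed.

End TreeMap.

Definition chase_map (J : interp) (t : elt) : dom J :=
  tree_map (indiv J (elt_root t)) t.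

(** In a model of the ABox every individual simulates itself for any number of rounds, so
    [tree_map_sound] applies to each tree, and edges between individuals are ABox edges. *)
Lemma chase_map_hom (T : tbox) (A : abox) (J : interp) n : model T A J ->
  (forall C t, cfact (chase T A n) C t -> cext C (chase_map J t)) /\
  (forall R t u, rfact (chase T A n) R t u ->
     rint R (chase_map J t) (chase_map J u)).
Proof.
move=> [JT [JC JR]].
have sound t : (forall C, cfact (chase T A n) C t -> cext C (chase_map J t)) /\
    (forall R u, rfact (chase T A n) R u t -> is_succ t ->
       rint R (tree_map (indiv J (elt_root t)) u) (chase_map J t)).
  apply: (@tree_map_sound J T A (fun _ a x => x = indiv J a)) => //.
  - by move=> _ a _ B -> /JC.
  - by move=> m a _ R D C c -> _ /JR Rac Dc; exists c, (indiv J c).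
  - by move=> m a _ R D C c -> _ /JR Rca Cc; exists c, (indiv J c).
split=> [C t|R t [b|u R' B] tu]; first by have [+ _] := sound t; apply.
  by have [a -> Rab] := rfact_ind tu; apply: JR.
have [ut _ _] := rfact_succ tu; subst u.
by have [_ /(_ R t tu isT)] := sound (Succ t R' B).
Qed.

(** * The canonical model *)

Section CanonicalModel.
Variables (T : tbox) (A : abox).
Notation N := (normal_form T).
Notation I := (canonical_model T A).

(** A concept occurring negatively in a Horn TBox is negation-free, so its truth rests on finitely
    many facts; one stage contains them, and [norm_neg] derives the name of the concept from
    them. *)
Lemma canonical_neg C (d : dom I) :
  {subset norm_neg C <= N} -> (forall D, (false, Neg D) \notin occurrences false C) ->
  cext C d -> exists n, cfact (chase T A n) C (chase_elt d).
Proof.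
elim: C d => [|B|D _|D IHD E IHE|R D IHD] d CN horn /=.
- move=> _; have [n dn] := cdom_chase_elt d; exists n.+1.
  by apply: sc_top dn; apply: CN; rewrite inE.
- by [].
- by have := horn D; rewrite /= mem_head.
- case=> /IHD [||n1 D1].
  + by move=> x xD; apply: CN; rewrite /= inE mem_cat xD orbT.
  + by move=> x; have := horn x; rewrite /= !inE mem_cat /=; apply: contra => ->.
  case/IHE=> [||n2 E2].
  + by move=> x xE; apply: CN; rewrite /= inE mem_cat xE !orbT.
  + move=> x; have := horn x; rewrite /= !inE mem_cat /=.
    by apply: contra => ->; rewrite orbT.
  exists (maxn n1 n2).+1; apply: (@sc_and _ _ D E).
  + by apply: CN; rewrite mem_head.
  + exact: cfact_mono (leq_maxl _ _) D1.
  + exact: cfact_mono (leq_maxr _ _) E2.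
- case=> e [n1 de] /IHD [||n2 De].
  + by move=> x xD; apply: CN; rewrite /= inE xD orbT.
  + by move=> x; have := horn x; rewrite /= !inE /=.
  exists (maxn n1 n2).+1; apply: (@sc_exl _ _ R D _ _ (chase_elt e)).
  + by apply: CN; rewrite mem_head.
  + exact: rfact_mono (leq_maxl _ _) de.
  + exact: cfact_mono (leq_maxr _ _) De.
Qed.

(** The inclusions of [norm_pos] pass a derived name on to the immediate subconcepts. Consistency
    serves the negations. *)
Lemma canonical_pos C (d : dom I) n :
  consistent T A ->
  {subset norm_pos C <= N} -> (forall D, (false, Neg D) \notin occurrences true C) ->
  cfact (chase T A n) C (chase_elt d) -> cext C d.
Proof.
move=> [J JTA]; elim/concept_size_ind: C d n => -[|B|D|D E|R D] IH d n CN horn.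
- by [].
- by move=> Bd; exists n.
- case: (neg_shapeP D) IH CN horn => [R E|E defN defo] IH CN horn Cd.
    case=> e [m de]; apply.
    apply: (IH E _ _ (maxn n m).+1) => /=; first by rewrite ltnS; do 3!apply: leqW.
    + by move=> x xE; apply: CN; rewrite /= inE xE orbT.
    + by move=> x; have := horn x; rewrite /= inE /=.
    apply: (@sc_all _ _ (All R E) R _ (chase_elt d)).
    + by apply: CN; rewrite mem_head.
    + exact: cfact_mono (leq_maxl _ _) Cd.
    + exact: rfact_mono (leq_maxr _ _) de.
  (* If [E] held at [d], the chase would derive [Bot] there, and [chase_map_hom] would realise [Bot]
     in the model [J]. *)
  rewrite defN in CN; move=> Ed.
  have [||m Em] := canonical_neg _ _ Ed.
  + by move=> x xE; apply: CN; rewrite !inE xE !orbT.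
  + by move=> x; have := horn x; rewrite defo inE.
  have [+ _] := chase_map_hom (maxn n m).+1 JTA.
  move=> /(_ Bot (chase_elt d)); apply=> //.
  apply: (@sc_and _ _ (Neg E) E).
  + by apply: CN; rewrite mem_head.
  + exact: cfact_mono (leq_maxl _ _) Cd.
  + exact: cfact_mono (leq_maxr _ _) Em.
- move=> Cd; split.
  + apply: (IH D _ _ n.+1) => /=; rewrite ?ltnS ?leq_addr //.
    * by move=> x xD; apply: CN; rewrite /= !inE mem_cat xD !orbT.
    * by move=> x; have := horn x; rewrite /= !inE mem_cat /=; apply: contra => ->.
    * by apply: (@sc_sub _ _ (And D E)) => //; apply: CN; rewrite mem_head.
  + apply: (IH E _ _ n.+1) => /=; rewrite ?ltnS ?leq_addl //.
    * by move=> x xE; apply: CN; rewrite /= !inE mem_cat xE !orbT.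
    * move=> x; have := horn x; rewrite /= !inE mem_cat /=.
      by apply: contra => ->; rewrite orbT.
    * by apply: (@sc_sub _ _ (And D E)) => //; apply: CN; rewrite !inE eqxx orbT.
- move=> Cd.
  have [m [u du Du]] : exists m, exists2 u,
      rfact (chase T A m) R (chase_elt d) u & cfact (chase T A m) D u.
    case: (pselect (exists2 u, rfact (chase T A n) R (chase_elt d) u
                             & cfact (chase T A n) D u)) => [|none].
      by exists n.
    have nS : needs_succ N (chase T A n) (chase_elt d) R D.
      by split=> //; exists (Ex R D) => //; apply: CN; rewrite mem_head.
    by exists n.+1, (Succ (chase_elt d) R D); [apply: sr_new | apply: sc_new].
  have [e eu] := chase_elt_onto du; subst u.
  exists e; first by exists m.
  apply: (IH D _ _ m) => //= x xD.
  by apply: CN; rewrite /= inE xD orbT.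
Qed.

Lemma canonical_model_is_model : horn T -> consistent T A -> model T A I.
Proof.
move=> [hornT _] cons; split; last first.
  by split=> [B a Ba|R a b Rab]; exists 0; [exists B, a | exists a, b].
move=> C D CD d Cd.
have occ E : (false, Neg E) \notin occurrences false C ++ occurrences true D.
  by apply/negP => HE; apply: (hornT E); exists (C, D).
have sub x : x \in NSub C D :: norm_neg C ++ norm_pos D -> x \in N.
  by move=> xCD; apply/mem_normal_form; exists (C, D).
have [||n Cn] := canonical_neg _ _ Cd.
- by move=> x xC; apply: sub; rewrite inE mem_cat xC orbT.
- by move=> x; have := occ x; rewrite mem_cat; apply: contra => ->.
apply: (@canonical_pos D d n.+1) => //.
- by move=> x xD; apply: sub; rewrite inE mem_cat xD !orbT.
- by move=> x; have := occ x; rewrite mem_cat; apply: contra => ->; rewrite orbT.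
- by apply: sc_sub Cn; apply: sub; rewrite mem_head.
Qed.

End CanonicalModel.

(** * Unravelling an ABox into a tree *)

Section Tree.
Variables (X : eqType) (e : rel X) (parent : X -> X) (height : X -> nat).
Hypothesis e_tree : forall x y, e x y ->
  (parent x = y /\ height y < height x) \/ (parent y = x /\ height x < height y).

(* Both cycle neighbours of a vertex of maximal height are its parent. *)
Lemma tree_ucycle c : ucycle e c -> size c <= 2.
Proof.
case/andP=> ec Uc; rewrite leqNgt; apply/negP => c3.
have [x xc xmax] : exists2 x, x \in c & forall y, y \in c -> height y <= height x.
  case: c c3 {ec Uc} => // x0 c _.
  elim: c x0 => [|y c IHc] x0.
    by exists x0 => [|y]; rewrite ?mem_head // inE => /eqP->.
  have [x xc xmax] := IHc y.
  case: (leqP (height x0) (height x)) => hx.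
    by exists x => [|z]; rewrite inE ?xc ?orbT // => /orP[/eqP->|/xmax].
  exists x0 => [|z]; rewrite ?mem_head // inE => /orP[/eqP->//|/xmax zx].
  exact: leq_trans zx (ltnW hx).
(* Rotate the cycle to start at [x]: its second and last vertices are the two neighbours of [x]. *)
have [i c' rc] := rot_to xc.
have Uc' : uniq (x :: c') by rewrite -rc rot_uniq.
have ec' : cycle e (x :: c') by rewrite -rc rot_cycle.
have mem' z : z \in x :: c' -> z \in c by rewrite -rc mem_rot.
have sz : 2 < size (x :: c') by rewrite -rc size_rot.
case: c' Uc' ec' mem' sz {rc} => [|y c'] //; case/lastP: c' => [|c' z] // Uc' ec' mem' _.
have exy : e x y by move: ec' => /= /andP[].
have ezx : e z x.
  by move: ec'; rewrite /= !rcons_path last_rcons => /and3P[].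
have yx : height y <= height x by apply: xmax; apply: mem'; rewrite !inE eqxx orbT.
have zx : height z <= height x.
  by apply: xmax; apply: mem'; rewrite !inE mem_rcons mem_head !orbT.
have py : parent x = y by case: (e_tree exy) => -[]; rewrite // ltnNge yx.
have pz : parent x = z by case: (e_tree ezx) => -[]; rewrite // ltnNge zx.
by move: Uc'; rewrite /= -py pz mem_rcons mem_head andbF.
Qed.
End Tree.

(* (true, R, c) stands for an edge R(b, c) and (false, R, c) for R(c, b), where b
   is the current individual; a node is the list of steps leading to it from the
   root, last step first. *)
Definition step : Type := (bool * nat * nat)%type.
Definition node := seq step.

Definition code (p : node) : iname := pickle p.

Lemma code_inj : injective code.
Proof. exact: (pcan_inj pickleK). Qed.

Definition step_edge (s : step) (b c : iname) : assertion :=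
  let: (fwd, R, _) := s in if fwd then RAss R b c else RAss R c b.

Lemma step_edge_inv s x y R c d : step_edge s x y = RAss R c d ->
  s.1.2 = R /\ if s.1.1 then c = x /\ d = y else c = y /\ d = x.
Proof. by case: s => -[[] R'] c' [-> -> ->]. Qed.

(** The individual of which the node is a copy. *)
Definition step_end (b : iname) (p : node) : iname :=
  if p is (_, _, c) :: _ then c else b.

Section Unravel.
Variables (A : abox) (sel : iname -> seq step) (b : iname).
Hypothesis sel_abox : forall c s, s \in sel c -> step_edge s c s.2 \in A.
Notation tip := (step_end b).

Fixpoint nodes (n : nat) : seq node :=
  [::] :: if n is m.+1
          then flatten [seq [seq s :: p | s <- sel (tip p)] | p <- nodes m]
          else [::].

Lemma nodes_cons n s p :
  (s :: p \in nodes n) = if n is m.+1 then (p \in nodes m) && (s \in sel (tip p)) else false.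
Proof.
case: n => // n; rewrite /= inE /=; apply/flatten_mapP/andP => [[p' pn]|[pn sp]].
  by case/mapP=> s' s's [-> ->].
by exists p => //; apply: map_f.
Qed.

Lemma nodes_nil n : [::] \in nodes n.
Proof. by case: n => [|n]; rewrite mem_head. Qed.

Lemma nodes_sub n m p : n <= m -> p \in nodes n -> p \in nodes m.
Proof.
elim: p n m => [|s p IHp] n m nm; first by rewrite !nodes_nil.
rewrite !nodes_cons; case: n nm => // n; case: m => // m nm /andP[/IHp-> // ->].
Qed.

Lemma nodes_size n p : p \in nodes n -> p \in nodes (size p).
Proof.
elim: p n => [|s p IHp] n; first by rewrite nodes_nil.
by rewrite !nodes_cons /=; case: n => // n /andP[/IHp-> ->].
Qed.

Definition node_assertions (p : node) : seq assertion :=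
  flatten [seq if x is CAss B c then if c == tip p then [:: CAss B (code p)] else [::]
               else [::] | x <- A]
  ++ if p is s :: p' then [:: step_edge s (code p') (code p)] else [::].

Definition unravel (n : nat) : abox := flatten [seq node_assertions p | p <- nodes n].

Lemma unravel_concept n B x : CAss B x \in unravel n <->
  exists2 p, p \in nodes n & x = code p /\ CAss B (tip p) \in A.
Proof.
split=> [/flatten_mapP[p pn]|[p pn [-> BA]]].
  rewrite mem_cat => /orP[/flatten_mapP[[B' c|R c d] yA]|] //.
    by case: eqP => // cp; rewrite inE => /eqP[-> ->]; exists p; rewrite -?cp.
  by case: p {pn} => // -[[[] R] c] p; rewrite inE => /eqP.
apply/flatten_mapP; exists p => //; rewrite mem_cat; apply/orP; left.
by apply/flatten_mapP; exists (CAss B (tip p)) => //; rewrite eqxx mem_head.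
Qed.

Lemma unravel_role n R x y : RAss R x y \in unravel n <->
  exists s p, s :: p \in nodes n /\ step_edge s (code p) (code (s :: p)) = RAss R x y.
Proof.
split=> [/flatten_mapP[p pn]|[s [p [pn def]]]].
  rewrite mem_cat => /orP[/flatten_mapP[[B' c|R' c d] yA]|] //.
    by case: eqP => // cp; rewrite inE => /eqP.
  by case: p pn => // s p pn; rewrite inE => /eqP->; exists s, p.
by apply/flatten_mapP; exists (s :: p) => //; rewrite mem_cat def mem_head orbT.
Qed.

Lemma adj_unravel n x y : adj (unravel n) x y <->
  exists s p, s :: p \in nodes n /\
    ((x = code p /\ y = code (s :: p)) \/ (y = code p /\ x = code (s :: p))).
Proof.
split=> [/hasP[[//|R c d] Rcd]|[s [p [pn xy]]]].
  have [s [p [pn /step_edge_inv[_ cd]]]] := (unravel_role n R c d).1 Rcd.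
  move=> xy; exists s, p; split=> //.
  by case: s.1.1 cd => -[<- <-]; case/orP: xy => /andP[/eqP-> /eqP->]; auto.
have /flatten_mapP : exists2 q, q \in nodes n &
    step_edge s (code p) (code (s :: p)) \in node_assertions q.
  by exists (s :: p) => //; rewrite mem_cat mem_head orbT.
rewrite -/(unravel n) => HA; apply/hasP; exists (step_edge s (code p) (code (s :: p))) => //.
by case: s {pn HA} xy => -[[] R] c [] [-> ->]; rewrite /= !eqxx ?orbT.
Qed.

Lemma ind_unravel n x : x \in ind (unravel n) -> exists2 p, p \in nodes n & x = code p.
Proof.
case/flatten_mapP=> -[B c|R c d].
  by case/unravel_concept=> p pn [-> _]; rewrite inE => /eqP->; exists p.
case/unravel_role=> s [p [pn /step_edge_inv[_ def]]] xcd.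
have pn' : p \in nodes n.
  case: n pn => // n; rewrite nodes_cons => /andP[+ _]; exact: nodes_sub.
have xsp : x = code p \/ x = code (s :: p).
  by move: xcd; case: s.1.1 def => -[-> ->]; rewrite !inE => /orP[] /eqP; auto.
by case: xsp => ->; [exists p | exists (s :: p)].
Qed.

(** Each of [p] and [p'] would be a one-step extension of the other. *)
Lemma no_2cycle (s s' : step) (p p' : node) :
  code p = code (s' :: p') -> code (s :: p) = code p' -> False.
Proof.
move=> /code_inj-> /code_inj/(congr1 size) /= /eqP.
by rewrite gtn_eqF // ltnW.
Qed.

(** Walks can pass through the root. For cycles, dropping the last step of the decoded path gives
    the parent and its length the height. An edge is determined by the last step of its longer end,
    which excludes a second role or direction. *)
Lemma unravel_tree n : ind (unravel n) != [::] -> tree_shaped (unravel n).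
Proof.
move=> V0; split; first split=> //.
- have up p : p \in nodes n ->
      exists2 l, path (adj (unravel n)) (code p) l & last (code p) l = code [::].
    elim: p => [|s p IHp] pn; first by exists [::].
    have pn' : p \in nodes n.
      by case: n pn {V0 IHp} => // n; rewrite nodes_cons => /andP[+ _]; apply: nodes_sub.
    have [l pl ll] := IHp pn'; exists (code p :: l) => //=; rewrite pl andbT.
    by apply/adj_unravel; exists s, p; split=> //; right.
  have down p : p \in nodes n ->
      exists2 l, path (adj (unravel n)) (code [::]) l & last (code [::]) l = code p.
    elim: p => [|s p IHp] pn; first by exists [::].
    have pn' : p \in nodes n.
      by case: n pn {V0 IHp up} => // n; rewrite nodes_cons => /andP[+ _]; apply: nodes_sub.
    have [l pl ll] := IHp pn'; exists (rcons l (code (s :: p))); last by rewrite last_rcons.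
    rewrite rcons_path pl ll; apply/adj_unravel; exists s, p; by split=> //; left.
  move=> x y /ind_unravel[p pn ->] /ind_unravel[q qn ->].
  have [l1 pl1 ll1] := up p pn; have [l2 pl2 ll2] := down q qn.
  by exists (l1 ++ l2); rewrite ?cat_path ?last_cat ll1 // pl1.
- pose dec x : node := odflt [::] (unpickle x).
  have decK p : dec (code p) = p by rewrite /dec /code pickleK.
  apply: (@tree_ucycle _ _ (fun x => code (behead (dec x))) (fun x => size (dec x))).
  move=> x y /adj_unravel[s [p [_ [[-> ->]|[-> ->]]]]]; rewrite !decK /=; [right|left]; by split.
- move=> R S x y /unravel_role[s [p [_ /step_edge_inv[<- xy]]]] SR.
  apply/negP => /unravel_role[s' [p' [_ /step_edge_inv[S_ xy']]]].
  apply: SR; rewrite -S_; case: s.1.1 xy xy' => -[-> ->]; case: s'.1.1 => -[E1 E2].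
  + by case: (code_inj E2) => ->.
  + by case: (no_2cycle E1 E2).
  + by case: (no_2cycle E2 E1).
  + by case: (code_inj E1) => ->.
- move=> R S x y /unravel_role[s [p [_ /step_edge_inv[_ xy]]]].
  apply/negP => /unravel_role[s' [p' [_ /step_edge_inv[_ xy']]]].
  case: (boolP s.1.1) xy xy' => fs [-> ->]; case: (boolP s'.1.1) => fs' [E1 E2].
  + by case: (no_2cycle E2 E1).
  + by case: (code_inj E1) fs' => <-; rewrite fs.
  + by case: (code_inj E2) fs => ->; rewrite fs'.
  + by case: (no_2cycle E1 E2).
Qed.

(** Steps are stored last first, so the suffixes of a node are the node and its ancestors. *)
Lemma suffix_cons (c p : node) s : suffix c (s :: p) = (c == s :: p) || suffix c p.
Proof.
apply/suffixP/orP => [[[|s' q] /= def]|[/eqP->|/suffixP[q ->]]].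
- by left; rewrite def.
- by right; case: def => _ ->; apply: suffix_suffix.
- by exists [::].
- by exists (s :: q).
Qed.

(** The parent of [p] does not count as a child: a walk from the root that avoids the parent never
    enters the subtree below it, where [p] lies. *)
Lemma child_unravel n p x : child (unravel n) (code [::]) (code p) x ->
  exists2 s, s \in sel (tip p) & x = code (s :: p).
Proof.
case=> /adj_unravel[s [q [qn [[/code_inj -> ->]|[-> /code_inj defp]]]]].
  by move=> _; exists s => //; case: n qn => // n; rewrite nodes_cons => /andP[].
case=> l [pl ll cl]; exfalso.
have avoid r : path (adj (unravel n)) (code r) l -> code q \notin code r :: l ->
    ~~ suffix q r -> exists2 r', last (code r) l = code r' & ~~ suffix q r'.
  elim: l r {pl ll cl} => [|y l IHl] r; first by exists r.
  move=> /= /andP[/adj_unravel[s' [q' [_ ry]]] pl].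
  rewrite !inE !negb_or => /and3P[qr qy ql] nqr.
  case: ry => -[E1 E2].
    rewrite -(code_inj E1) in E2; rewrite {}E2 in pl qy *.
    apply: IHl => //; first by rewrite inE negb_or qy ql.
    by rewrite suffix_cons negb_or nqr andbT; apply: contra qy => /eqP->.
  rewrite {}E1 in pl qy *; apply: IHl => //; first by rewrite inE negb_or qy ql.
  by move: nqr; rewrite (code_inj E2) suffix_cons negb_or => /andP[].
have [|r' lr nr] := avoid [::] pl cl; last first.
  by move: nr; rewrite (code_inj (etrans (esym lr) ll)) defp suffix_cons suffix_refl orbT.
move: cl; rewrite inE negb_or => /andP[+ _]; apply: contra.
by case/suffixP => -[|//] /= <-.
Qed.

Lemma unravel_outdegree n k : code [::] \in ind (unravel n) ->
  (forall c, size (sel c) <= k) -> outdegree_le k (unravel n).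
Proof.
move=> r_in selk; exists (code [::]) => // x cs /ind_unravel[p pn ->] Ucs csP.
apply: leq_trans (selk (tip p)); rewrite -(size_map (fun s => code (s :: p))).
apply: uniq_leq_size => // c /csP /child_unravel[s sp ->].
by apply/mapP; exists s.
Qed.

(** Sends each copy to its original; a name that codes no node goes to [b]. *)
Definition unravel_hom (x : iname) : iname := tip (odflt [::] (unpickle x)).

Lemma unravel_homE p : unravel_hom (code p) = tip p.
Proof. by rewrite /unravel_hom pickleK. Qed.

Lemma unravel_hom_concept n B x :
  CAss B x \in unravel n -> CAss B (unravel_hom x) \in A.
Proof. by case/unravel_concept=> p _ [-> ?]; rewrite unravel_homE. Qed.

Lemma unravel_hom_role n R x y :
  RAss R x y \in unravel n -> RAss R (unravel_hom x) (unravel_hom y) \in A.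
Proof.
case/unravel_role=> s [p [pn def]].
have sp : s \in sel (tip p) by case: n pn => // n; rewrite nodes_cons => /andP[].
move: (sel_abox sp) def; case: s {pn sp} => -[[] R'] c /= + [<- <- <-];
  by rewrite !unravel_homE.
Qed.

End Unravel.

(** * Pulling models back along a renaming of individuals *)

Definition name_map (I : interp) (g : iname -> iname) (x : iname + dom I) : dom I :=
  match x with inl a => indiv I (g a) | inr d => d end.

(* The domain of I with additional copies of the individuals, so that each name a
   denotes a copy of g a. *)
Definition rename (I : interp) (g : iname -> iname) : interp := @Interp (dom I)
  (fun B x => cint B (name_map g x))
  (fun R x y => rint R (name_map g x) (name_map g y)).

Lemma cext_rename I g C (x : dom (rename I g)) : cext C x <-> cext C (name_map g x).
Proof.
elim: C x => [|B|D IHD|D IHD E IHE|R D IHD] x //=.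
- by rewrite IHD.
- by rewrite IHD IHE.
- split=> [[y xy /IHD Dy]|[d xd Dd]]; first by exists (name_map g y).
  by exists (inr d) => //; apply/IHD.
Qed.

Lemma model_rename T A A' I g : model T A I ->
  (forall B a, CAss B a \in A' -> CAss B (g a) \in A) ->
  (forall R a b, RAss R a b \in A' -> RAss R (g a) (g b) \in A) ->
  model T A' (rename I g).
Proof.
move=> [IT [IC IR]] gC gR; split.
  by move=> C D CD x /cext_rename Cx; apply/cext_rename; apply: IT CD _ Cx.
by split=> [B a /gC /IC|R a c /gR /IR].
Qed.

(** * Selecting the neighbours that matter for the chase *)

Section Selection.
Variables (T : tbox) (A : abox).

(** Since [c] satisfies [D] no later than any other [R]-successor, it alone decides at every stage
    whether the rule for [Ex R D] fires at [b]. *)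
Definition best_succ (b : iname) R D (c : iname) : Prop :=
  RAss R b c \in A /\ forall n c', RAss R b c' \in A ->
    cfact (chase T A n) D (Ind c') -> cfact (chase T A n) D (Ind c).

Definition best_pred (b : iname) R C (c : iname) : Prop :=
  RAss R c b \in A /\ forall n c', RAss R c' b \in A ->
    cfact (chase T A n) C (Ind c') -> cfact (chase T A n) C (Ind c).

Definition sel_nci (b : iname) (x : nci) : seq step :=
  match x with
  | NExL R D _ =>
      if pselect (exists c, best_succ b R D c) is left p
      then [:: (true, R, projT1 (cid p))] else [::]
  | NAll C R _ =>
      if pselect (exists c, best_pred b R C c) is left p
      then [:: (false, R, projT1 (cid p))] else [::]
  | _ => [::]
  end.

Definition neighbours (b : iname) : seq step :=
  flatten [seq if x is RAss R c d
               then (if c == b then [:: (true, R, d)] else [::]) ++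
                    (if d == b then [:: (false, R, c)] else [::])
               else [::] | x <- A].

(* One arbitrary neighbour is added so that the root of an unravelling is an
   individual of it even if it satisfies no concept assertion. *)
Definition sel (b : iname) : seq step :=
  take 1 (neighbours b) ++ flatten [seq sel_nci b x | x <- normal_form (undup T)].

(** [sel] runs over [undup T] because [tbox_size] ignores repetitions; the inclusions are the
    same. *)
Lemma mem_normal_form_undup x : (x \in normal_form (undup T)) = (x \in normal_form T).
Proof.
apply/mem_normal_form/mem_normal_form => -[ci ciT xci]; exists ci => //.
  by rewrite -mem_undup.
by rewrite mem_undup.
Qed.

Lemma sel_abox b s : s \in sel b -> step_edge s b s.2 \in A.
Proof.
rewrite mem_cat => /orP[/mem_take|]; case/flatten_mapP=> -[].
- by [].
- move=> R c d cdA; rewrite mem_cat => /orP[]; case: eqP => // <-;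
    by rewrite inE => /eqP->.
- by [].
- by [].
- by move=> R D C _ /=; case: pselect => // p; case: cid => c [? ?]; rewrite inE => /eqP->.
- by [].
- by [].
- by [].
- by move=> C R D _ /=; case: pselect => // p; case: cid => c [? ?]; rewrite inE => /eqP->.
Qed.

Lemma sel_ex b R D C c n : NExL R D C \in normal_form T -> RAss R b c \in A ->
  cfact (chase T A n) D (Ind c) ->
  exists2 c', (true, R, c') \in sel b & cfact (chase T A n) D (Ind c').
Proof.
move=> DC bc Dc.
have best : exists c', best_succ b R D c'.
  apply: (@earliest_witness (fun c => RAss R b c \in A)
                            (fun n c => cfact (chase T A n) D (Ind c))).
    by move=> m k d mk; apply: cfact_mono.
  by exists n, c.
case E : (pselect (exists c', best_succ b R D c')) => [p|//].
exists (projT1 (cid p)); last by case: cid => c' /= [_ /(_ n c bc Dc)].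
rewrite mem_cat; apply/orP; right; apply/flatten_mapP; exists (NExL R D C).
  by rewrite mem_normal_form_undup.
by rewrite /= E mem_head.
Qed.

Lemma sel_all b R D C c n : NAll C R D \in normal_form T -> RAss R c b \in A ->
  cfact (chase T A n) C (Ind c) ->
  exists2 c', (false, R, c') \in sel b & cfact (chase T A n) C (Ind c').
Proof.
move=> DC bc Cc.
have best : exists c', best_pred b R C c'.
  apply: (@earliest_witness (fun c => RAss R c b \in A)
                            (fun n c => cfact (chase T A n) C (Ind c))).
    by move=> m k d mk; apply: cfact_mono.
  by exists n, c.
case E : (pselect (exists c', best_pred b R C c')) => [p|//].
exists (projT1 (cid p)); last by case: cid => c' /= [_ /(_ n c bc Cc)].
rewrite mem_cat; apply/orP; right; apply/flatten_mapP; exists (NAll C R D).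
  by rewrite mem_normal_form_undup.
by rewrite /= E mem_head.
Qed.

Lemma sel_role R b c : RAss R b c \in A \/ RAss R c b \in A -> exists s, s \in sel b.
Proof.
move=> bc; have [s sb] : exists s, s \in neighbours b.
  case: bc => bc; [exists (true, R, c) | exists (false, R, c)]; apply/flatten_mapP.
    by exists (RAss R b c) => //; rewrite eqxx mem_cat mem_head.
  by exists (RAss R c b) => //; rewrite eqxx mem_cat mem_head orbT.
case E : (neighbours b) sb => [|s' l] // _.
by exists s'; rewrite /sel E mem_head.
Qed.

End Selection.

(** * Bounding the number of selected neighbours *)

Definition nci_weight (x : nci) : nat :=
  match x with NExL _ _ _ | NAll _ _ _ => 1 | _ => 0 end.

Lemma norm_neg_weight C : \sum_(x <- norm_neg C) nci_weight x <= concept_size C.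
Proof.
elim: C => [||D _|D IHD E IHE|R D IHD] /=; rewrite ?big_nil //.
- by rewrite big_seq1.
- by rewrite big_cons big_cat /= add0n; apply: leqW; apply: leq_add.
- by rewrite big_cons /= add1n ltnS leqW.
Qed.

Lemma norm_pos_weight C : \sum_(x <- norm_pos C) nci_weight x <= concept_size C.
Proof.
elim/concept_size_ind: C => -[||D|D E|R D] IH; rewrite ?big_nil //.
- case: (neg_shapeP D) IH => [R E|E -> _] IH.
    rewrite big_cons /= add1n ltnS; do 3!apply: leqW.
    by apply: IH; rewrite /= ltnS; do 3!apply: leqW.
  by rewrite !big_cons /= !add0n; apply: leqW; apply: norm_neg_weight.
- rewrite !big_cons big_cat /= !add0n; apply: leqW.
  by apply: leq_add; apply: IH; rewrite /= ltnS ?leq_addr ?leq_addl.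
- by rewrite big_cons /= add0n; do 2!apply: leqW; apply: IH => /=.
Qed.

(** Each neighbour selected for an inclusion is charged to an occurrence of [Ex R D] or [All R D],
    and the arbitrary one to the inclusion symbol of some member of [T], which exists as [T] is
    nonempty. *)
Lemma size_sel T A b : T <> [::] -> size (sel T A b) <= tbox_size T.
Proof.
move=> T0.
have szf s : size (flatten [seq sel_nci T A b x | x <- s]) <= \sum_(x <- s) nci_weight x.
  elim: s => [|x s IHs]; rewrite ?big_nil // big_cons /= size_cat leq_add //.
  by case: x => //= *; case: pselect.
have weight s : \sum_(x <- normal_form s) nci_weight x + size s <=
    \sum_(ci <- s) (concept_size ci.1 + concept_size ci.2).+1.
  elim: s => [|ci s IHs]; first by rewrite !big_nil.
  have -> : normal_form (ci :: s) =
    NSub ci.1 ci.2 :: (norm_neg ci.1 ++ norm_pos ci.2) ++ normal_form s by [].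
  rewrite !big_cons !big_cat /= add0n addSn addnS ltnS -addnA.
  by rewrite leq_add // leq_add ?norm_neg_weight ?norm_pos_weight.
rewrite size_cat; apply: leq_trans (weight (undup T)).
rewrite addnC leq_add //; rewrite size_take_min; apply: leq_trans (geq_minl _ _) _.
case: T T0 {szf weight} => // ci T _.
have : ci \in undup (ci :: T) by rewrite mem_undup mem_head.
by case: (undup _).
Qed.

(** * Embedding the chase trees of a single individual *)

(* The part of the chase seen by the maximal S-connected subinterpretation. *)
Fixpoint connected_elt (S : signature) (T : tbox) (A : abox) (n : nat) (t : elt) : Prop :=
  match t with
  | Ind a => a \in ind A
  | Succ u R B =>
      [/\ connected_elt S T A n u, sigR S R & rfact (chase T A n) R u t]
  end.

Lemma connected_elt_mono S T A m n t :
  m <= n -> connected_elt S T A m t -> connected_elt S T A n t.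
Proof.
move=> mn; elim: t => //= u IHu R B [/IHu cu SR ur]; split=> //.
exact: rfact_mono mn ur.
Qed.

Lemma connected_elt_rfact S T A m n R t u : connected_elt S T A m t -> sigR S R ->
  rfact (chase T A n) R t u -> exists k, connected_elt S T A k u.
Proof.
move=> ct SR tu; case: u tu => [b|u R' B] tu.
  by exists 0; have [a _ /ind_role[]] := rfact_ind tu.
have [? ? _] := rfact_succ tu; subst u R'; exists (maxn m n); split=> //.
  exact: connected_elt_mono (leq_maxl _ _) ct.
exact: rfact_mono (leq_maxr _ _) tu.
Qed.

Lemma connected_elt_rfact_inv S T A m n R t u : connected_elt S T A m u ->
  rfact (chase T A n) R t u -> exists k, connected_elt S T A k t.
Proof.
move=> cu tu; case: u tu cu => [b|u R' B] tu.
  by exists 0; have [a -> /ind_role[]] := rfact_ind tu.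
by have [? ? _] := rfact_succ tu; subst u R' => -[cu _ _]; exists m.
Qed.

(** The share of the tree at [b] in the final homomorphism, up to stage [n]. Fixing [Ind b] lets the
    maps of different trees agree on ABox edges. *)
Definition tree_hom (S : signature) (T : tbox) (A : abox) (I : interp) (n : nat)
    (b : iname) (h : elt -> dom I) : Prop :=
  [/\ h (Ind b) = indiv I b,
      forall t B, elt_root t = b -> connected_elt S T A n t -> sigC S B ->
        cfact (chase T A n) (Name B) t -> cint B (h t)
    & forall u R B, elt_root u = b -> connected_elt S T A n (Succ u R B) ->
        rint R (h u) (h (Succ u R B))].

(** For the empty TBox the outdegree bound is 0 while [sel] may keep one neighbour, so this case is
    separate: the chase adds nothing to the ABox. *)
Lemma tree_hom_nil (S : signature) (A : abox) (I : interp) (n : nat) (b : iname) :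
  sat_abox I A -> tree_hom S [::] A n b (fun _ => indiv I b).
Proof.
move=> [IC _].
have init : (forall C t, cfact (chase [::] A n) C t -> cfact (chase_init A) C t) /\
            (forall R t u, rfact (chase [::] A n) R t u -> rfact (chase_init A) R t u).
  elim: n => [|n [IHc IHr]] //; split=> [C t|R t u].
  - by case=> {C t} [C t /IHc||||||t R B [[]]].
  - by case=> {R t u} [R t u /IHr|t R B [[]]].
have [initc initr] := init.
split=> // [t B rt _ _ /initc[_ [a [[<-] ta Ba]]]|u R B _ [_ _ /initr]].
  by rewrite ta /= in rt; rewrite -rt; apply: IC.
by case=> ? [? []].
Qed.

(** Three maps are composed: [tree_map] into the canonical model of the unravelling, the assumed
    embedding of that model into [rename I g], and [name_map g] back to [I]. *)
Lemma tree_hom_exists (S : signature) (T T1 : tbox) (S1 : signature) (A : abox)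
    (I : interp) (n : nat) (b : iname) :
  horn T ->
  (forall A', sig_abox S1 A' -> tree_shaped A' -> outdegree_le (tbox_size T) A' ->
     consistent T1 A' -> consistent T A' ->
     forall I1 : interp, model T1 A' I1 ->
       con_hom_embeddable S A' (canonical_model T A') I1) ->
  sig_abox S1 A -> consistent T A -> model T1 A I -> b \in ind A ->
  exists h : elt -> dom I, tree_hom S T A n b h.
Proof.
move=> hornT embed [sC sR] [I2 I2m] Im bA.
case: (pselect (T = [::])) => [->|T0].
  by exists (fun _ => indiv I b); apply: tree_hom_nil; case: Im.
(* Depth [n] covers [n] rounds; the extra level gives the root a neighbour even for [n = 0], so that
   it is an individual of [A']. *)
pose A' := unravel A (sel T A) b n.+1; pose g := unravel_hom b.
have gC B a : CAss B a \in A' -> CAss B (g a) \in A by apply: unravel_hom_concept.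
have gR R a c : RAss R a c \in A' -> RAss R (g a) (g c) \in A.
  by apply: unravel_hom_role => c' s; apply: sel_abox.
have rA' : code [::] \in ind A'.
  case/flatten_mapP: bA => -[B a BaA|R a c acA].
    rewrite inE => /eqP ba; subst a; apply: (@ind_concept _ B).
    by apply/unravel_concept; exists [::]; rewrite ?nodes_nil.
  move=> bac; have [s sb] : exists s, s \in sel T A b.
    move: bac; rewrite !inE => /orP[] /eqP->; apply: sel_role; [left|right]; exact: acA.
  have sn : [:: s] \in nodes (sel T A) b n.+1 by rewrite nodes_cons nodes_nil.
  have [R' [x [y [def xy]]]] : exists R x y,
      step_edge s (code [::]) (code [:: s]) = RAss R x y /\ (x = code [::] \/ y = code [::]).
    case: (s) => -[[] R'] c'; first by exists R', (code [::]), (code [:: (true, R', c')]); auto.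
    by exists R', (code [:: (false, R', c')]), (code [::]); auto.
  have /ind_role[xA yA] : RAss R' x y \in A' by apply/unravel_role; exists s, [::].
  by case: xy => <-.
have mod' := model_rename _ gC gR.
have cons' : consistent T A' by exists (rename I2 g); apply: mod' I2m.
pose J := canonical_model T A'.
have [JT [JC JR]] : model T A' J by apply: canonical_model_is_model.
have [|||||f [fC fR fI]] := embed A' _ _ _ _ cons' (rename I g) _.
- by split=> [B a /gC /sC|R a c /gR /sR].
- by apply: unravel_tree; apply: contraL rA' => /eqP->.
- by apply: unravel_outdegree rA' _ => c; apply: size_sel.
- by exists (rename I g); apply: mod' Im.
- exact: mod' Im.
(* Passing to a neighbour costs one level of the unravelling and one round, so a node at depth
   [size p] still simulates its original for the remaining rounds. *)
pose P k a (x : dom J) := exists p, [/\ p \in nodes (sel T A) b n.+1,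
  size p + k <= n.+1, step_end b p = a & x = indiv J (code p)].
have P_next k s p : p \in nodes (sel T A) b n.+1 -> size p + k.+1 <= n.+1 ->
    s \in sel T A (step_end b p) -> s :: p \in nodes (sel T A) b n.+1.
  move=> pn pk sp; have pn' : s :: p \in nodes (sel T A) b (size p).+1.
    by rewrite nodes_cons (nodes_size pn).
  by apply: nodes_sub pn'; apply: leq_trans pk; rewrite addnS ltnS leq_addr.
have sound k t x : P k (elt_root t) x ->
    (forall C, cfact (chase T A k) C t -> cext C (tree_map x t)) /\
    (forall R u, rfact (chase T A k) R u t -> is_succ t ->
       rint R (tree_map x u) (tree_map x t)).
  apply: tree_map_sound => {k t x} //.
  - move=> k a x [p [pn pk pa xp]]; exists p; split=> //.
    by apply: leq_trans pk; rewrite leq_add2l.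
  - move=> k a x B [p [pn pk pa ->]] Ba; apply: JC.
    by apply/unravel_concept; exists p; rewrite // pa.
  - move=> k a x R D C c [p [pn pk pa ->]] DC ac Dc.
    have [c' sc Dc'] := sel_ex DC ac Dc; rewrite -pa in sc.
    have pn' := P_next _ _ _ pn pk sc.
    exists c', (indiv J (code ((true, R, c') :: p))); split=> //.
      by exists ((true, R, c') :: p); rewrite /= addSnnS.
    by apply: JR; apply/unravel_role; exists (true, R, c'), p.
  - move=> k a x R D C c [p [pn pk pa ->]] DC ac Dc.
    have [c' sc Dc'] := sel_all DC ac Dc; rewrite -pa in sc.
    have pn' := P_next _ _ _ pn pk sc.
    exists c', (indiv J (code ((false, R, c') :: p))); split=> //.
      by exists ((false, R, c') :: p); rewrite /= addSnnS.
    by apply: JR; apply/unravel_role; exists (false, R, c'), p.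
pose x0 := indiv J (code [::]).
have Px0 : P n b x0 by exists [::]; rewrite nodes_nil; split.
have Px0t t : elt_root t = b -> P n (elt_root t) x0 by move->.
have con t : elt_root t = b -> connected_elt S T A n t -> con_dom S A' (tree_map x0 t).
  elim: t => [a|u IHu R B] rt /=; first by move=> _; apply: con_ind.
  case=> cu SR ur; apply: con_step (IHu rt cu) SR _.
  by have [_ /(_ _ _ ur isT)] := sound n (Succ u R B) x0 (Px0t (Succ u R B) rt).
exists (fun t => name_map g (f (tree_map x0 t))); split.
- rewrite [f _]fI //; exact: con_ind.
- move=> t B rt ct SB Bt; apply: (fC B) => //; first exact: con.
  by have [/(_ _ Bt)] := sound n t x0 (Px0t t rt).
- move=> u R B ru cu; have [cu' SR ur] := cu; apply: (fR R) => //.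
  + exact: con.
  + exact: (con (Succ u R B)).
  by have [_ /(_ _ _ ur isT)] := sound n (Succ u R B) x0 (Px0t (Succ u R B) ru).
Qed.

(** * From embeddings to entailment *)

Lemma rcq_entails_of_embeddings (T1 T2 : tbox) (Theta : signature * signature) :
  horn T2 ->
  (forall A : abox,
     sig_abox Theta.1 A -> tree_shaped A -> outdegree_le (tbox_size T2) A ->
     consistent T1 A -> consistent T2 A ->
     forall I1 : interp, model T1 A I1 ->
       con_hom_embeddable Theta.2 A (canonical_model T2 A) I1) ->
  rcq_entails Theta T1 T2.
Proof.
case: Theta => S1 S /= hornT embed A sA _ cons2 q a rq [qC qR] sza aA ent I Im.
have [v va [vC vR]] := ent _ (canonical_model_is_model hornT cons2).
pose e x := chase_elt (v x).
(* Rootedness: the query path from an answer variable to [x] is a path of [S]-edges in the chase, in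
   either direction, starting at an individual. *)
have qcon x : x \in flatten (map atom_vars (atoms q)) ->
    exists n, connected_elt S T2 A n (e x).
  have ans y : y \in answer q -> exists n, connected_elt S T2 A n (e y).
    move=> ya; have iy : index y (answer q) < size (answer q) by rewrite index_mem.
    have : v y = indiv _ (nth 0 a (index y (answer q))).
      rewrite -(nth_map 0 (v 0)) ?sza // -va (nth_map 0) ?nth_index //.
    by rewrite /e => ->; exists 0; apply: aA; rewrite mem_nth // sza.
  move=> xq; case: (boolP (x \in answer q)) => [/ans //|xna].
  have [|y ya] := rq x; first by rewrite /quantified xq.
  elim=> [|R z w _ [m zc] zw|R z w _ [m zc] wz]; first exact: ans.
    have [k zwk] := vR _ _ _ zw; exact: connected_elt_rfact zc (qR _ _ _ zw) zwk.
  have [k wzk] := vR _ _ _ wz; exact: connected_elt_rfact_inv zc wzk.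
have [n1 con1] : exists n, forall x, x \in flatten (map atom_vars (atoms q)) ->
    connected_elt S T2 A n (e x).
  by apply: common_stage => // m n x; apply: connected_elt_mono.
pose at_stage n t := match t with
  | CAtom B x => cfact (chase T2 A n) (Name B) (e x)
  | RAtom R x y => rfact (chase T2 A n) R (e x) (e y) end.
have [n2 sat2] : exists n, forall t, t \in atoms q -> at_stage n t.
  apply: common_stage => [m n [B x|R x y] mn|[B x|R x y]].
  - exact: cfact_mono. - exact: rfact_mono. - exact: vC. - exact: vR.
(* The match involves finitely many elements and facts, so a single stage contains it, and
   homomorphisms up to that stage suffice. *)
pose n := maxn n1 n2.
have con x : x \in flatten (map atom_vars (atoms q)) -> connected_elt S T2 A n (e x).
  by move/con1; apply: connected_elt_mono; apply: leq_maxl.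
have satC B x : CAtom B x \in atoms q -> cfact (chase T2 A n) (Name B) (e x).
  by move/sat2; apply: cfact_mono; apply: leq_maxr.
have satR R x y : RAtom R x y \in atoms q -> rfact (chase T2 A n) R (e x) (e y).
  by move/sat2; apply: rfact_mono; apply: leq_maxr.
have rootA t : connected_elt S T2 A n t -> elt_root t \in ind A.
  by elim: t => //= u IHu R B [/IHu].
have exh b : exists hb : elt -> dom I, b \in ind A -> tree_hom S T2 A n b hb.
  case: (boolP (b \in ind A)) => bA; last by exists (fun _ => indiv I b).
  by have [hb] := tree_hom_exists n hornT embed sA cons2 Im bA; exists hb.
have [h hP] := choice exh.
have hI b : b \in ind A -> h b (Ind b) = indiv I b by case/hP.
(* Each variable is moved by the homomorphism of the tree that contains its match. *)
exists (fun x => h (elt_root (e x)) (e x)).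
  rewrite (map_comp (fun d => h (elt_root (chase_elt d)) (chase_elt d)) v) va.
  rewrite -map_comp; apply/eq_in_map => b ba /=; exact/hI/aA.
split=> [B x Bx|R x y Rxy].
  have cx : connected_elt S T2 A n (e x).
    by apply: con; apply/flatten_mapP; exists (CAtom B x); rewrite // inE.
  by have [_ hC _] := hP _ (rootA _ cx); apply: hC => //; [apply: qC Bx | apply: satC].
have := satR _ _ _ Rxy.
have cy : connected_elt S T2 A n (e y).
  by apply: con; apply/flatten_mapP; exists (RAtom R x y); rewrite // !inE eqxx orbT.
have := hP _ (rootA _ cy).
(* Only ABox edges join different trees, and they join roots, which are fixed; any other edge lies
   inside one tree. *)
case: (e y) cy => [b|u R' B] cy [_ _ hR] xy.
  have [c -> Rcb] := rfact_ind xy; have [cA bA] := ind_role Rcb.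
  by rewrite /= !hI //; have [_ [_]] := Im; apply.
have [? ? _] := rfact_succ xy; subst u R'.
exact: hR.
Qed.

(** * Compactness *)

(* K k i j constrains the values at i and j; the index k, over concept and role
   names, makes each finite set of constraints expressible by a query. *)
Lemma finite_choice_compactness (Y : Type) (F : nat -> seq Y)
    (K : nat -> nat -> nat -> Y -> Y -> Prop) :
  (forall m, exists f : nat -> Y, forall i, i < m -> List.In (f i) (F i) /\
     forall j k, j < m -> k < m -> K k i j (f i) (f j)) ->
  exists f : nat -> Y, forall i j k, K k i j (f i) (f j).
Proof.
pose good m f := forall i, i < m -> List.In (f i) (F i) /\
  forall j k, j < m -> k < m -> K k i j (f i) (f j).
(* As in König's lemma, values are fixed one by one, keeping prefixes that extend to good
   assignments for every [m]. *)
move=> exgood; pose ext (s : seq Y) := forall m, exists f,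
  good m f /\ mkseq f (size s) = s.
have good_sub m m' f : m <= m' -> good m' f -> good m f.
  move=> mm' gf i im; have [fi Kf] := gf i (leq_trans im mm').
  by split=> // j k jm km; apply: Kf; apply: leq_trans mm'.
have ext0 : ext [::] by move=> m; have [f gf] := exgood m; exists f.
have extS s : ext s -> exists y, ext (rcons s y).
  move=> exts; apply: contrapT => none.
  (* If no value extended [s], each of the finitely many candidates would fail from some bound on;
     [bnd] is a bound for all of them. *)
  have [bnd bndP] : exists bnd, forall y, List.In y (F (size s)) -> forall f,
      good bnd f -> mkseq f (size s) = s -> f (size s) <> y.
    elim: (F (size s)) => [|y l [b1 Hb1]]; first by exists 0.
    have [b2 Hb2] : exists b2, forall f, good b2 f -> mkseq f (size s) = s -> f (size s) <> y.
      apply: contrapT => nob; apply: none; exists y => m.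
      apply: contrapT => nom; apply: nob; exists m => f gf sf fy; apply: nom.
      by exists f; rewrite size_rcons mkseqS sf fy.
    exists (maxn b1 b2) => z [<-|zl] f gf.
      by apply: Hb2; apply: good_sub gf; apply: leq_maxr.
    by apply: (Hb1 _ zl); apply: good_sub gf; apply: leq_maxl.
  (* The bound must exceed [size s] for [f (size s)] to be one of the candidates. *)
  have [f [gf sf]] := exts (maxn bnd (size s).+1).
  apply: (bndP (f (size s)) _ f _ sf) => //.
    by have [] := gf (size s); rewrite ?leq_maxr.
  by apply: good_sub gf; apply: leq_maxl.
have [f0 _] := exgood 0.
have exnext s : exists y, ext s -> ext (rcons s y).
  by case: (pselect (ext s)) => [/extS[y ?]|?]; [exists y | exists (f0 0)].
have [next nextP] := choice exnext.
pose fix pre n := if n is m.+1 then rcons (pre m) (next (pre m)) else [::].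
have ext_pre n : ext (pre n) by elim: n => //= n; apply: nextP.
have size_pre n : size (pre n) = n by elim: n => //= n IHn; rewrite size_rcons IHn.
pose f n := next (pre n).
have pre_mkseq n : pre n = mkseq f n by elim: n => //= n IHn; rewrite mkseqS -IHn.
exists f => i j k; pose m := maxn (maxn i j) k.
have [im jm km] : [/\ i < m.+1, j < m.+1 & k < m.+1].
  by rewrite !ltnS /m !leq_max !leqnn !orbT.
have [g [gg]] := ext_pre m.+1 m.+1; rewrite size_pre pre_mkseq => gf.
have gE l : l < m.+1 -> g l = f l.
  by move=> lm; have /(congr1 (nth (g 0) ^~ l)) := gf; rewrite !nth_mkseq.
by have [_ /(_ j k jm km)] := gg i im; rewrite !gE.
Qed.

(** * Numbering the elements of the chase *)

Fixpoint concept_code (C : concept) : nat :=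
  match C with
  | Top => CodeSeq.code [:: 0]
  | Name B => CodeSeq.code [:: 1; B]
  | Neg D => CodeSeq.code [:: 2; concept_code D]
  | And D E => CodeSeq.code [:: 3; concept_code D; concept_code E]
  | Ex R D => CodeSeq.code [:: 4; R; concept_code D]
  end.

Lemma concept_code_inj : injective concept_code.
Proof.
elim=> [|B|D IHD|D IHD E IHE|R D IHD] [|B'|D'|D' E'|R' D']
  => /(can_inj CodeSeq.codeK) // [].
- by move->.
- by move/IHD->.
- by move=> /IHD-> /IHE->.
- by move=> -> /IHD->.
Qed.

(** Query variables are numbers, so chase elements need numbers to serve as variables. *)
Fixpoint elt_code (t : elt) : nat :=
  match t with
  | Ind a => CodeSeq.code [:: 0; a]
  | Succ u R B => CodeSeq.code [:: 1; elt_code u; R; concept_code B]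
  end.

Lemma elt_code_inj : injective elt_code.
Proof.
elim=> [a|u IHu R B] [a'|u' R' B'] /(can_inj CodeSeq.codeK) // [].
  by move->.
by move=> /IHu-> -> /concept_code_inj->.
Qed.

(** The entries of a list are below its code. Hence a query cut off at some code contains, with an
    element, the whole path from its root, which keeps it rooted. *)
Lemma elt_code_Succ u R B :
  elt_code u < elt_code (Succ u R B) /\ R < elt_code (Succ u R B).
Proof.
by have /and5P[] := CodeSeq.ltn_code [:: 1; elt_code u; R; concept_code B].
Qed.

(** * Finitely branching submodels *)

Fixpoint subconcepts (C : concept) : seq concept :=
  C :: match C with
       | Top | Name _ => [::]
       | Neg D => subconcepts D
       | And D E => subconcepts D ++ subconcepts E
       | Ex _ D => subconcepts D
       end.

Section Prune.
Variables (I : interp) (T : tbox) (A : abox).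

Definition tbox_concepts : seq concept :=
  flatten [seq subconcepts ci.1 ++ subconcepts ci.2 | ci <- T].

(** [succ_choice] returns [d] itself when there is no witness; the last clause then keeps the loop
    only if [I] has it. *)
Definition prune : interp := @Interp (anon I) (fun B d => @cint I B d)
  (fun R d e =>
     (exists a b, [/\ d = inl a, e = inl b & RAss R a b \in A]) \/
     (exists C, [/\ Ex R C \in tbox_concepts, e = @succ_choice I d R C
                  & @rint I R d e])).

Lemma rint_prune R (d e : dom I) : sat_abox I A ->
  @rint prune R d e -> @rint I R d e.
Proof. by move=> [_ IR] [[a [b [-> -> /IR]]]|[C []]]. Qed.

(** Every edge of [prune] is an edge of [I], and each true [Ex R D] from the TBox keeps a witness;
    being an equivalence, the claim passes through negation. *)
Lemma cext_prune C (d : dom I) : sat_abox I A ->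
  {subset subconcepts C <= tbox_concepts} -> @cext prune C d <-> cext C d.
Proof.
move=> IA; elim: C d => [|B|D IHD|D IHD E IHE|R D IHD] d sub //=.
- by rewrite IHD // => x xD; apply: sub; rewrite inE xD orbT.
- rewrite IHD ?IHE // => x xD; apply: sub;
    by rewrite /= inE mem_cat xD ?orbT.
- have {}IHD e : @cext prune D e <-> @cext I D e.
    by apply: IHD => x xD; apply: sub; rewrite inE xD orbT.
  split=> [[e de /IHD De]|[e de De]].
    by exists e => //; apply: rint_prune.
  have [dw Dw] := @succ_choiceP I d R D (ex_intro _ e (conj de De)).
  exists (@succ_choice I d R D); last exact/IHD.
  by right; exists D; split=> //; apply: sub; rewrite mem_head.
Qed.

Lemma prune_model : model T A I -> model T A prune.
Proof.
move=> [IT IA]; have [IC IR] := IA; split; last first.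
  by split=> [B a /IC //|R a b Rab]; left; exists a, b.
move=> C D CD d.
have sub x : x \in subconcepts C ++ subconcepts D -> x \in tbox_concepts.
  by move=> xCD; apply/flatten_mapP; exists (C, D).
rewrite !cext_prune //; first exact: IT.
- by move=> x xD; apply: sub; rewrite mem_cat xD orbT.
- by move=> x xC; apply: sub; rewrite mem_cat xC.
Qed.

Definition prune_succs (d : dom I) : seq (dom I) :=
  map (@indiv I) (ind A) ++
  [seq if C is Ex R D then @succ_choice I d R D else d | C <- tbox_concepts].

Fixpoint ball (n : nat) : seq (dom I) :=
  if n is m.+1 then ball m ++ List.flat_map prune_succs (ball m)
  else map (@indiv I) (ind A).

Lemma In_map_mem (X : eqType) Y (f : X -> Y) x s : x \in s -> List.In (f x) (map f s).
Proof.
by elim: s => //= y s IHs; rewrite inE => /orP[/eqP->|/IHs]; auto.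
Qed.

Lemma ball_mono m n d : m <= n -> List.In d (ball m) -> List.In d (ball n).
Proof.
move/subnK <-; elim: (n - m) => // k IHk /IHk dk.
by rewrite addSn; apply: List.in_or_app; left.
Qed.

Lemma ball_step n R (d e : dom I) :
  List.In d (ball n) -> @rint prune R d e -> List.In e (ball n.+1).
Proof.
move=> dn de; apply: List.in_or_app; right; apply/List.in_flat_map; exists d; split=> //.
apply: List.in_or_app; case: de => [[a [b [_ -> /ind_role[_ bA]]]]|[C [Cs -> _]]].
  by left; apply: In_map_mem.
by right; apply: (In_map_mem (fun C => if C is Ex R D then @succ_choice I d R D else d) Cs).
Qed.

End Prune.

(** * Conjunctive queries describing finite parts of the chase *)

Section ChaseQuery.
Variables (S : signature) (T : tbox) (A : abox).

Definition conn (t : elt) : Prop := exists n, connected_elt S T A n t.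

Lemma con_dom_conn (d : dom (canonical_model T A)) : con_dom S A d -> conn (chase_elt d).
Proof.
elim=> [a aA|R e f _ [m em] SR [n ef]]; first by exists 0.
exact: connected_elt_rfact em SR ef.
Qed.

Definition has_cfact (B i : nat) : Prop := exists t n,
  [/\ conn t, elt_code t = i, sigC S B & cfact (chase T A n) (Name B) t].

Definition has_rfact (R i j : nat) : Prop := exists t u n,
  [/\ conn t /\ conn u, elt_code t = i, elt_code u = j, sigR S R & rfact (chase T A n) R t u].

(** Cutting off both names and element codes at [m] makes the query finite; the facts to include are
    chosen classically. *)
Definition chase_query (m : nat) : cq := CQ [seq elt_code (Ind a) | a <- ind A]
  ([seq CAtom k i | k <- iota 0 m, i <- [seq i <- iota 0 m | `[< has_cfact k i >]]] ++
   [seq RAtom k ij.1 ij.2 | k <- iota 0 m,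
      ij <- [seq ij <- [seq (i, j) | i <- iota 0 m, j <- iota 0 m]
            | `[< has_rfact k ij.1 ij.2 >]]]).

Lemma chase_query_concept m B i : CAtom B i \in atoms (chase_query m) <->
  [/\ B < m, i < m & has_cfact B i].
Proof.
rewrite mem_cat; split.
  case/orP=> /allpairsPdep[k [x [+ + E]]] //; case: E => -> ->.
  by rewrite mem_filter !mem_iota !add0n => /andP[_ ?] /andP[/asboolP ? /andP[_ ?]].
case=> Bm im Bi; apply/orP; left; apply/allpairsPdep; exists B, i; split=> //.
  by rewrite mem_iota add0n.
by rewrite mem_filter mem_iota add0n im !andbT; apply/asboolP.
Qed.

Lemma chase_query_role m R i j : RAtom R i j \in atoms (chase_query m) <->
  [/\ R < m, i < m, j < m & has_rfact R i j].
Proof.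
rewrite mem_cat; split.
  case/orP=> /allpairsPdep[k [x [+ + E]]] //; case: E => -> -> ->.
  rewrite mem_filter => + /andP[/asboolP xR /allpairsP[[i' j'] /= [+ + E]]].
  by rewrite !mem_iota !add0n E in xR * => /andP[_ ?] /andP[_ ?] /andP[_ ?].
case=> Rm im jm Rij; apply/orP; right; apply/allpairsPdep; exists R, (i, j); split=> //.
  by rewrite mem_iota add0n.
rewrite mem_filter; apply/andP; split; first exact/asboolP.
by apply/allpairsP; exists (i, j); rewrite !mem_iota !add0n.
Qed.

Lemma chase_query_sig m : sig_cq S (chase_query m).
Proof.
split=> [B x /chase_query_concept[_ _ [t [n [_ _ SB _]]]]|R x y] //.
by case/chase_query_role=> _ _ _ [t [u [n [_ _ _ SR _]]]].
Qed.

Lemma chase_query_succ m u R B : elt_code (Succ u R B) < m -> conn (Succ u R B) ->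
  conn u /\ RAtom R (elt_code u) (elt_code (Succ u R B)) \in atoms (chase_query m).
Proof.
move=> tm ct; have [n [cu SR ur]] := ct.
have [um Rm] := elt_code_Succ u R B.
have cu' : conn u by exists n.
split=> //; apply/chase_query_role; split=> //; rewrite ?(ltn_trans _ tm) //.
by exists u, (Succ u R B), n.
Qed.

Lemma chase_query_rooted m : rooted (chase_query m).
Proof.
move=> y /andP[yq _].
have [t [ct ty tm]] : exists t, [/\ conn t, elt_code t = y & y < m].
  case/flatten_mapP: yq => -[B x|R x x'].
    case/chase_query_concept=> Bm xm [t [n [ct tx _ _]]]; rewrite inE => /eqP->.
    by exists t.
  case/chase_query_role=> Rm xm xm' [t [u [n [[ct cu] tx ux' _ _]]]].
  by rewrite !inE => /orP[] /eqP->; [exists t | exists u].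
subst y; elim: t ct tm {yq} => [a|u IHu R B] ct tm.
  exists (elt_code (Ind a)); last exact: qconn_refl.
  by have [n aA] := ct; apply: map_f.
have [cu ur] := chase_query_succ tm ct.
have [x xa xu] := IHu cu (ltn_trans (elt_code_Succ u R B).1 tm).
by exists x => //; apply: qconn_fwd xu ur.
Qed.

Lemma chase_query_entailed m : entails_cq T A (chase_query m) (ind A).
Proof.
move=> J Jm.
(* Variables are decoded and sent through [chase_map]; [indiv J 0] is a junk value for numbers that
   code no element. *)
pose v i := if pselect (exists t, elt_code t = i) is left p
  then chase_map J (projT1 (cid p)) else indiv J 0.
have vE t : v (elt_code t) = chase_map J t.
  rewrite /v; case: pselect => [p|[]]; last by exists t.
  by case: cid => u /= /elt_code_inj->.
exists v; first by rewrite -map_comp; apply/eq_in_map => a _; apply: vE (Ind a).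
split=> [B x /chase_query_concept[_ _ [t [n [_ <- _ Bt]]]]|R x y].
  by have [/(_ _ _ Bt)] := chase_map_hom n Jm; rewrite vE.
case/chase_query_role=> _ _ _ [t [u [n [_ <- <- _ tu]]]].
by have [_ /(_ _ _ _ tu)] := chase_map_hom n Jm; rewrite !vE.
Qed.

End ChaseQuery.

(** * From entailment to embeddings *)

Lemma embedding_of_rcq_entails (T1 T2 : tbox) (Theta : signature * signature)
    (A : abox) (I : interp) :
  rcq_entails Theta T1 T2 -> sig_abox Theta.1 A -> ind A != [::] ->
  consistent T2 A -> model T1 A I ->
  con_hom_embeddable Theta.2 A (canonical_model T2 A) I.
Proof.
case: Theta => S1 S /= ent sA A0 cons2 Im.
have [_ IA] := Im.
(* Finite branching leaves finitely many candidate images for each chase element. *)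
pose J := prune I T1 A; have Jm : model T1 A J by apply: prune_model.
have [a0 a0A] : exists a, a \in ind A.
  by case: (ind A) A0 => // a l _; exists a; rewrite mem_head.
(* The constraints say that a map on codes is a homomorphism on the connected part that fixes the
   individuals. *)
pose K k i j (y z : dom J) := forall t u, elt_code t = i -> elt_code u = j ->
  conn S T2 A t -> [/\ forall n, sigC S k -> cfact (chase T2 A n) (Name k) t -> cint k y,
    forall n, conn S T2 A u -> sigR S k -> rfact (chase T2 A n) k t u -> rint k y z
    & forall a, t = Ind a -> y = indiv J a].
have [|f fP] := @finite_choice_compactness (dom J) (@ball I T1 A) K.
  move=> m.
  have [w wa [wC wR]] : sat_cq J (chase_query S T2 A m) (ind A).
    apply: ent Jm => //; first by exists I.
    - exact: chase_query_rooted.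
    - exact: chase_query_sig.
    - by rewrite size_map.
    - exact: chase_query_entailed.
  have wI a : a \in ind A -> w (elt_code (Ind a)) = indiv J a.
    by move: wa; rewrite -map_comp => /eq_in_map; apply.
  (* The depth of an element is at most its code, so [ball i] can hold the candidates for the
     element coded by [i]. *)
  have wball t : conn S T2 A t -> elt_code t < m ->
      List.In (w (elt_code t)) (@ball I T1 A (elt_code t)).
    elim: t => [a [n aA] _|u IHu R B ct tm].
      by rewrite wI //; apply: ball_mono (leq0n _) _; apply: In_map_mem.
    have [cu ur] := chase_query_succ tm ct; have [ult _] := elt_code_Succ u R B.
    apply: (ball_mono ult); apply: ball_step (wR _ _ _ ur).
    exact: IHu cu (ltn_trans ult tm).
  (* Codes of no connected element are unconstrained; they get an individual, which lies in every
     ball. *)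
  exists (fun i => if `[< exists2 t, elt_code t = i & conn S T2 A t >]
                   then w i else indiv J a0).
  move=> i im; split.
    case: asboolP => [[t ti ct]|_]; first by subst i; apply: wball.
    by apply: ball_mono (leq0n _) _; apply: In_map_mem.
  move=> j k jm km t u ti uj ct; subst i j.
  case: asboolP => [_|[]]; last by exists t.
  split=> [n Sk kt|n cu Sk tu|a ta].
  - by apply: wC; apply/chase_query_concept; split=> //; exists t, n.
  - case: asboolP => [_|[]]; last by exists u.
    by apply: wR; apply/chase_query_role; split=> //; exists t, u, n.
  - by subst t; apply: wI; case: ct.
exists (fun d => f (elt_code (chase_elt d))); split.
- move=> B d SB /con_dom_conn cd [n Bd].
  by have [/(_ n SB Bd)] := fP _ _ B _ (chase_elt d) erefl erefl cd.
- move=> R d e SR /con_dom_conn cd /con_dom_conn ce [n de].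
  have [_ H _] := fP _ _ R _ (chase_elt e) erefl erefl cd.
  exact: (rint_prune IA (H n ce SR de)).
- move=> a aA _; have ca : conn S T2 A (Ind a) by exists 0.
  by have [_ _ /(_ a erefl)] := fP _ _ 0 _ (Ind a) erefl erefl ca.
Qed.

Theorem theorem10 (T1 T2 : tbox) (Theta : signature * signature)
    (hornT2 : horn T2) :
  rcq_entails Theta T1 T2 <->
  (forall A : abox,
     sig_abox Theta.1 A -> tree_shaped A -> outdegree_le (tbox_size T2) A ->
     consistent T1 A -> consistent T2 A ->
     forall I1 : interp, model T1 A I1 ->
       con_hom_embeddable Theta.2 A (canonical_model T2 A) I1).
Proof.
split; last exact: rcq_entails_of_embeddings.
move=> ent A sA [[A0 _ _] _ _] _ _ cons2 I Im.
exact: embedding_of_rcq_entails ent sA A0 cons2 Im.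
Qed.
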